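(* Let $\alpha\in\mathbb{C}$ with $|\alpha|=1$ and let $D$ be an $\alpha$-monograph of second kind. Then $\sigma_\alpha(D)=-\sigma(\Gamma(D))$, i.e., the eigenvalues of $H^\alpha(D)$ are the negatives of the eigenvalues of the adjacency matrix of $\Gamma(D)$, with multiplicities.
   Context: A mixed graph $D$ is obtained from a finite simple undirected graph $\Gamma(D)$ by replacing some edges by arcs: between any two adjacent vertices $u,v$ there is exactly one of a digon $u\sim v$, an arc $u\to v$, or an arc $v\to u$; cycles refer to $\Gamma(D)$. For $|\alpha|=1$, $H^\alpha(D)=[h_{uv}]$ has $h_{uv}=1$ if $u\sim v$, $\alpha$ if $u\to v$, $\bar\alpha$ if $v\to u$, $0$ otherwise; $\sigma_\alpha(D)$ is its multiset of eigenvalues and $\sigma(\Gamma(D))$ that of the ordinary adjacency matrix of $\Gamma(D)$. A mixed walk $W=v_1,\dots,v_k$ has value $h_\alpha(W)=h_{v_1v_2}\cdots h_{v_{k-1}v_k}$ and $g_\alpha(W)=(-1)^{k+1}h_\alpha(W)$. For a cycle $C$ with vertices $v_1,\dots,v_\ell$ in cyclic order, a traversal $\vec C$ is the closed walk $v_1,\dots,v_\ell,v_1$ (either direction, any start), so $g_\alpha(\vec C)=(-1)^\ell h_\alpha(\vec C)$. $D$ is an $\alpha$-monograph of second kind if $g_\alpha(\vec C)=1$ for every cycle $C$ and every traversal $\vec C$. *)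

(* Defs.v *)
From HB Require Import structures.
From mathcomp Require Import all_boot all_order all_algebra.
From mathcomp Require Import reals complex.

Set Implicit Arguments.
Unset Strict Implicit.
Unset Printing Implicit Defensive.

Import Order.TTheory GRing.Theory Num.Theory.

Local Open Scope ring_scope.
Local Open Scope complex_scope.

(* [mg_adj] is the adjacency relation of the underlying simple graph Gamma(D);
   [mg_arc u v] says that the edge uv has been replaced by the arc u -> v.
   The edges carrying no arc are the digons. *)
Record mixed_graph (V : finType) := MixedGraph {
  mg_adj : rel V;
  mg_arc : rel V;
  mg_adj_sym : symmetric mg_adj;
  mg_adj_irr : irreflexive mg_adj;
  mg_arc_adj : forall u v, mg_arc u v -> mg_adj u v;
  mg_arc_asym : forall u v, mg_arc u v -> ~~ mg_arc v u
}.

Definition mg_digon (V : finType) (D : mixed_graph V) : rel V :=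
  fun u v => [&& mg_adj D u v, ~~ mg_arc D u v & ~~ mg_arc D v u].

Definition hcoef (R : realType) (V : finType) (alpha : R[i])
    (D : mixed_graph V) (u v : V) : R[i] :=
  if mg_digon D u v then 1
  else if mg_arc D u v then alpha
  else if mg_arc D v u then Num.conj alpha
  else 0.

(* Matrices are indexed by 'I_#|V| through the enumeration of V. *)
Definition Halpha (R : realType) (V : finType) (alpha : R[i])
    (D : mixed_graph V) : 'M[R[i]]_#|V| :=
  \matrix_(i, j) hcoef alpha D (enum_val i) (enum_val j).

Definition adjmx (R : realType) (V : finType) (D : mixed_graph V) :
    'M[R[i]]_#|V| :=
  \matrix_(i, j) (mg_adj D (enum_val i) (enum_val j))%:R.

(* The eigenvalues with (algebraic) multiplicity, listed in an arbitrary order: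
   the roots of the characteristic polynomial, which is monic. Spectra are to
   be compared up to [perm_eq]. *)
Definition spectrum (R : realType) (n : nat) (A : 'M[R[i]]_n) : seq R[i] :=
  sval (closed_field_poly_normal (char_poly A)).

(* A walk v_1, ..., v_k is given by the list of its vertices;
   [zip w (behead w)] lists the pairs (v_i, v_(i+1)). *)
Definition walk_h (R : realType) (V : finType) (alpha : R[i])
    (D : mixed_graph V) (w : seq V) : R[i] :=
  \prod_(e <- zip w (behead w)) hcoef alpha D e.1 e.2.

Definition walk_g (R : realType) (V : finType) (alpha : R[i])
    (D : mixed_graph V) (w : seq V) : R[i] :=
  (-1) ^+ (size w).+1 * walk_h alpha D w.

(* A cycle of Gamma(D) is given by its distinct vertices in cyclic order. *)
Definition is_cycle (V : finType) (D : mixed_graph V) (c : seq V) : Prop :=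
  (2 < size c)%N /\ ucycle (mg_adj D) c.

Definition close_walk (V : finType) (c : seq V) : seq V :=
  if c is v :: _ then rcons c v else [::].

Definition is_traversal (V : finType) (c w : seq V) : Prop :=
  exists k : nat,
    w = close_walk (rot k c) \/ w = close_walk (rot k (rev c)).

Definition monograph_second_kind (R : realType) (V : finType) (alpha : R[i])
    (D : mixed_graph V) : Prop :=
  forall c : seq V, is_cycle D c ->
  forall w : seq V, is_traversal c w -> walk_g alpha D w = 1.

(* Main.v *)
(** Weight each ordered pair of adjacent vertices [u, v] by [- h_uv].  Opposite
    pairs have inverse weights, and the hypothesis says exactly that every
    cycle has weight 1.  A closed walk with a repeated vertex splits into two
    shorter closed walks, so every closed walk has weight 1, and the weights
    come from a potential: [- h_uv = d v / d u] on edges.  Hence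
    [diag(d) H = - A diag(d)], so [H] and [- A] are similar. *)
Require Import Defs.
From HB Require Import structures.
From mathcomp Require Import all_boot all_order all_algebra.
From mathcomp Require Import reals complex.

Set Implicit Arguments.
Unset Strict Implicit.
Unset Printing Implicit Defensive.

Import Order.TTheory GRing.Theory Num.Theory.

Local Open Scope ring_scope.
Local Open Scope complex_scope.

Lemma not_uniq_split (T : eqType) (s : seq T) :
  ~~ uniq s -> exists y p1 p2 p3, s = p1 ++ y :: p2 ++ y :: p3.
Proof.
elim: s => //= a s IHs; rewrite negb_and negbK => /orP[|/IHs].
  by case/splitPr=> p2 p3; exists a, [::], p2, p3.
by case=> y [p1 [p2 [p3 ->]]]; exists y, (a :: p1), p2, p3.
Qed.

(** The product of [walk_h] for an arbitrary weight, so that [walk_h alpha D] is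
    [gain (hcoef alpha D)] by conversion. *)
Definition gain (K : fieldType) (V : Type) (f : V -> V -> K) (w : seq V) : K :=
  \prod_(e <- zip w (behead w)) f e.1 e.2.

Lemma gain1 (K : fieldType) (V : Type) (f : V -> V -> K) (x : V) :
  gain f [:: x] = 1.
Proof. exact: big_nil. Qed.

Lemma gain_cons2 (K : fieldType) (V : Type) (f : V -> V -> K) (x y : V) p :
  gain f [:: x, y & p] = f x y * gain f (y :: p).
Proof. exact: big_cons. Qed.

Lemma gain_cat (K : fieldType) (V : Type) (f : V -> V -> K) (x : V) p q :
  gain f (x :: p ++ q) = gain f (x :: p) * gain f (last x p :: q).
Proof.
elim: p x => [|y p IHp] x /=; first by rewrite gain1 mul1r.
by rewrite !gain_cons2 IHp mulrA.
Qed.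

Lemma gain_rcons (K : fieldType) (V : Type) (f : V -> V -> K) (x y : V) p :
  gain f (x :: rcons p y) = gain f (x :: p) * f (last x p) y.
Proof. by rewrite -cats1 gain_cat gain_cons2 gain1 mulr1. Qed.

Lemma gain_opp (K : fieldType) (V : Type) (f : V -> V -> K) (x : V) p :
  gain (fun u v => - f u v) (x :: p) = (-1) ^+ size p * gain f (x :: p).
Proof.
elim: p x => [|y p IHp] x; first by rewrite !gain1 mul1r.
by rewrite !gain_cons2 IHp exprS /= mulN1r !mulNr mulrCA.
Qed.

Section Balance.

Variables (K : fieldType) (V : finType) (e : rel V) (f : V -> V -> K).
Hypothesis e_sym : symmetric e.
Hypothesis e_irr : irreflexive e.
Hypothesis f_inv : forall u v, e u v -> f u v * f v u = 1.
Hypothesis f_cycle : forall x p,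
  (2 < size (x :: p))%N -> ucycle e (x :: p) -> gain f (x :: rcons p x) = 1.

(** Strong induction on the number of edges, [size p]. The start [x] recurs as the last element of
    [p], so [uniq p] says that nothing repeats except at the closure. *)
Lemma gain_closed x p : path e x p -> last x p = x -> gain f (x :: p) = 1.
Proof.
have [n] := ubnP (size p); elim: n x p => // n IHn x p.
have [|/not_uniq_split[y [p1 [p2 [p3 ->]]]]] := boolP (uniq p).
  case/lastP: p => [|q y]; first by rewrite gain1.
  move=> uq _ ep; rewrite last_rcons => yx; rewrite {y}yx in uq ep *.
  have cyc: ucycle e (x :: q).
    by rewrite /ucycle /= ep /= -rcons_uniq.
  (* An empty [q] would be a loop; a single vertex gives an edge walked forth and back, settled by
     [f_inv]; anything longer is a genuine cycle. *)
  case: q uq ep cyc => [|y [|z q]] uq ep cyc; last exact: f_cycle.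
    by move: ep; rewrite /= e_irr.
  move: ep => /= /and3P[exy _ _].
  by rewrite !gain_cons2 gain1 mulr1 f_inv.
move=> sz ep lp.
move: ep; rewrite cat_path /= cat_path /= => /and5P[ep1 e1 ep2 e2 ep3].
(* Cut at the repeated vertex [y]: the closed walk [y, p2, y] is excised, and [x, p1, y, p3]
   remains. Both have fewer edges. *)
have sz1: (size (rcons p2 y) < n)%N.
  move: sz; rewrite !(size_cat, size_rcons) /= size_cat /= !addnS ltnS.
  by apply: leq_ltn_trans; rewrite ltnS addnCA leq_addr.
have sz2: (size (p1 ++ y :: p3) < n)%N.
  move: sz; rewrite !size_cat /= size_cat /= !addnS ltnS.
  by apply: leq_ltn_trans; rewrite ltnS leq_add2l leq_addl.
have g2: gain f (y :: rcons p2 y) = 1.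
  by apply: IHn => //; [rewrite rcons_path ep2 | rewrite last_rcons].
have g13: gain f (x :: p1 ++ y :: p3) = 1.
  apply: IHn => //; first by rewrite cat_path /= ep1 e1.
  by move: lp; rewrite !last_cat /= last_cat.
rewrite -g13 !gain_cat !gain_cons2 -cat_rcons gain_cat g2 last_rcons.
by rewrite mul1r.
Qed.

(** [q] runs back along [p]; each edge cancels against its reverse by [f_inv]. *)
Lemma path_inverse x p : path e x p ->
  exists q, [/\ path e (last x p) q, last (last x p) q = x
              & gain f (x :: p) * gain f (last x p :: q) = 1].
Proof.
elim: p x => [|y p IHp] x /=; first by exists [::]; rewrite gain1 mulr1.
case/andP=> exy /IHp[q [eq lq gq]]; exists (rcons q x); split.
- by rewrite rcons_path eq lq e_sym.
- by rewrite last_rcons.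
by rewrite gain_cons2 gain_rcons lq [f x y * _]mulrC mulrACA gq mul1r f_inv.
Qed.

(** [d u] is the gain of a chosen path to [u] from the canonical root of its component, so
    connectedness is not assumed. *)
Lemma gain_potential : exists d : V -> K,
  (forall u, d u != 0) /\ (forall u v, e u v -> d u * f u v = d v).
Proof.
have ex_path u : exists p, path e (fingraph.root e u) p
                           && (last (fingraph.root e u) p == u).
  have: connect e (fingraph.root e u) u.
    by rewrite (sym_connect_sym e_sym) connect_root.
  by case/connectP=> p ep lp; exists p; rewrite ep -lp /=.
pose P u := xchoose (ex_path u).
have P_path u : path e (fingraph.root e u) (P u).
  by case/andP: (xchooseP (ex_path u)).
have P_last u : last (fingraph.root e u) (P u) = u.
  by case/andP: (xchooseP (ex_path u)) => _ /eqP.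
exists (fun u => gain f (fingraph.root e u :: P u)); split=> [u | u v euv].
  have [q [_ _ gq]] := path_inverse (P_path u).
  by apply: contra_eq_neq gq => ->; rewrite mul0r eq_sym oner_eq0.
have r_uv : fingraph.root e u = fingraph.root e v.
  by apply/(fingraph.rootP (sym_connect_sym e_sym)); apply: connect1.
have [q [eq lq gq]] := path_inverse (P_path v).
rewrite P_last in eq lq gq.
(* Go from the root to [u], cross the edge to [v], and return along [q], whose gain is the inverse
   of [d v]. *)
have g1 : gain f (fingraph.root e u :: rcons (P u) v ++ q) = 1.
  apply: gain_closed.
    by rewrite cat_path rcons_path P_path P_last euv last_rcons.
  by rewrite last_cat last_rcons lq.
move: g1; rewrite gain_cat gain_rcons last_rcons P_last => g1.
by rewrite -[LHS]mulr1 -gq mulrCA g1 mulr1.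
Qed.

End Balance.

(** [P] also intertwines [X - A] and [X - B]; take determinants and cancel that of [P], a nonzero
    constant polynomial. *)
Lemma char_poly_intertwine (K : fieldType) n (P A B : 'M[K]_n) :
  \det P != 0 -> P *m A = B *m P -> char_poly A = char_poly B.
Proof.
move=> dP PA; rewrite /char_poly.
have dP0 : \det (map_mx polyC P) != 0 by rewrite det_map_mx polyC_eq0.
apply: (mulfI dP0); rewrite -det_mulmx [RHS]mulrC -det_mulmx; congr (\det _).
rewrite /char_poly_mx mulmxBr mulmxBl -!map_mxM PA.
by rewrite mul_scalar_mx mul_mx_scalar.
Qed.

(** Substituting [- X] for [X] turns [X - A] into [-(X + A)]; the [n] rows yield the sign. *)
Lemma char_polyN (K : fieldType) n (A : 'M[K]_n) :
  char_poly (- A) = (-1) ^+ n * (char_poly A \Po - 'X).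
Proof.
rewrite /char_poly -[_ \Po _]/(comp_poly _ _) -det_map_mx -detZ; congr (\det _).
apply/matrixP=> i j; rewrite !mxE /= linearB /= comp_polyC.
rewrite linearMn /= comp_polyX rmorphN /= mulN1r opprB opprK mulNrn.
by rewrite opprK addrC.
Qed.

Lemma char_poly_spectrum (R : realType) n (A : 'M[R[i]]_n) :
  char_poly A = \prod_(z <- spectrum A) ('X - z%:P).
Proof.
rewrite /spectrum; case: closed_field_poly_normal => s /= {1}->.
by rewrite (monicP (char_poly_monic A)) scale1r.
Qed.

Lemma spectrum_opp (R : realType) n (A : 'M[R[i]]_n) :
  perm_eq (spectrum (- A)) [seq - x | x <- spectrum A].
Proof.
apply: prod_XsubC_eq; rewrite -char_poly_spectrum char_polyN.
(* With exactly [n] roots, the sign [(-1) ^+ n] supplies one factor [-1] per linear factor, turning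
   [- X - z] into [X + z]. *)
have szA : size (spectrum A) = n.
  have := size_char_poly A.
  by rewrite char_poly_spectrum size_prod_XsubC => -[].
rewrite char_poly_spectrum big_map; move: (spectrum A) szA => s <- {A}.
elim: s => [|z s IHs]; first by rewrite !big_nil comp_polyC mul1r.
rewrite !big_cons -IHs comp_polyM exprS mulrACA; congr (_ * _).
by rewrite comp_polyB comp_polyX comp_polyC mulN1r opprB polyCN !opprK addrC.
Qed.

Lemma hcoef_inv (R : realType) (V : finType) (alpha : R[i])
    (D : mixed_graph V) u v :
  `|alpha| = 1 -> mg_adj D u v -> hcoef alpha D u v * hcoef alpha D v u = 1.
Proof.
move=> a1 uv; rewrite /hcoef /mg_digon (mg_adj_sym D v u) uv /=.
have aa : alpha * Num.conj alpha = 1 by rewrite -normCK a1 expr1n.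
have [auv|nuv] := boolP (mg_arc D u v).
  by rewrite (negbTE (mg_arc_asym auv)) /=.
by have [avu|nvu] := boolP (mg_arc D v u); rewrite /= ?mulr1 1?mulrC.
Qed.

Lemma hcoef_nonadj (R : realType) (V : finType) (alpha : R[i])
    (D : mixed_graph V) u v : ~~ mg_adj D u v -> hcoef alpha D u v = 0.
Proof.
move=> nuv; rewrite /hcoef /mg_digon (negbTE nuv) /=.
rewrite (contraNF (@mg_arc_adj _ D u v) nuv).
by rewrite mg_adj_sym in nuv; rewrite (contraNF (@mg_arc_adj _ D v u) nuv).
Qed.

Theorem theorem5p14 (R : realType) (V : finType) (alpha : R[i])
    (D : mixed_graph V) :
  `|alpha| = 1 ->
  monograph_second_kind alpha D ->
  perm_eq (spectrum (Halpha alpha D))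
          [seq - x | x <- spectrum (adjmx R D)].
Proof.
move=> a1 monoD.
pose f u v := - hcoef alpha D u v.
have f_inv u v : mg_adj D u v -> f u v * f v u = 1.
  by move=> uv; rewrite mulrNN hcoef_inv.
have f_cycle x p : (2 < size (x :: p))%N -> ucycle (mg_adj D) (x :: p) ->
    gain f (x :: rcons p x) = 1.
  move=> sz cyc; rewrite gain_opp size_rcons.
  have /(_ (x :: rcons p x)) := monoD _ (conj sz cyc).
  (* A cycle of length [l] closes to a list of [l + 1] vertices, so [walk_g] carries
     [(-1) ^+ (l + 2)], which equals the sign of a product of [l] negated weights. *)
  rewrite /walk_g /= size_rcons !exprS !mulN1r !opprK; apply.
  by exists 0%N; left; rewrite rot0.
have [d [d_neq0 d_edge]] :=
  gain_potential (@mg_adj_sym _ D) (@mg_adj_irr _ D) f_inv f_cycle.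
(* [spectrum] depends on the matrix only through its characteristic polynomial. *)
suff cp : char_poly (Halpha alpha D) = char_poly (- adjmx R D).
  by rewrite /spectrum cp; exact: spectrum_opp.
apply: (@char_poly_intertwine _ _ (diag_mx (\row_i d (enum_val i)))).
  by rewrite det_diag; apply/prodf_neq0 => i _; rewrite mxE.
apply/matrixP=> i j; rewrite mul_diag_mx mul_mx_diag !mxE.
case: (boolP (mg_adj D _ _)) => [uv|nuv].
  by rewrite mulN1r -(d_edge _ _ uv) /f mulrN opprK.
by rewrite hcoef_nonadj // mulr0 oppr0 mul0r.
Qed.
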